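(* Let $M$ be a continuous-time Markov chain with i.i.d. exponential waiting times $\{W_k,\ k\in\mathbb{N}_+\}$ of parameter $\lambda>0$, let $\sigma=\{\sigma(t),\ t\in\mathbb{R}_+\}$ be a right-continuous, almost surely strictly increasing process, independent of $M$, with no deterministic points of discontinuity and with $\sigma(0)=0$ almost surely, let $\psi$ be the inverse of $\sigma$, and let $Y(t):=M(\psi(t))$, $t\in\mathbb{R}_+$. Denote by $\{J_k,\ k\in\mathbb{N}_+\}$ the waiting times of $Y$ and by $\boldsymbol{J}_n:=(J_1,\dots,J_n)$ the vector of the first $n$ of them. Then the waiting times are given by $$J_{n+1}=\sigma(T_{n+1})-\sigma(T_n^-),\qquad n\in\mathbb{N},$$ where $T_n:=\sum_{k=1}^nW_k$, $T_0:=0$. Moreover, for each $n\in\mathbb{N}_+$, the distribution of the random vector $\boldsymbol{J}_n$ is given by $$\mathbb{E}e^{i\langle\boldsymbol{\xi},\boldsymbol{J}_n\rangle}=\lambda^n\int_{\mathbb{R}_+^n}\varphi_{\boldsymbol{\sigma}(B_n\boldsymbol{w}_n)}\big(A_n^T\boldsymbol{\xi}\big)\,e^{-\lambda\sum_{j=1}^nw_j}\,dw_1\cdots dw_n,\qquad\boldsymbol{\xi}\in\mathbb{R}^n,$$ where $\boldsymbol{w}_n:=(w_1,\dots,w_n)^T$ and $\varphi_{\boldsymbol{\sigma}(\boldsymbol{t}_n)}(\cdot)$ is the characteristic function of the vector $\boldsymbol{\sigma}(\boldsymbol{t}_n)$.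
   Context: $\mathbb{N}=\{0,1,2,\dots\}$, $\mathbb{N}_+=\{1,2,\dots\}$, $\mathbb{R}_+=[0,\infty)$. The chain: $M(t)=\tilde M(N(t))$, where $\tilde M=\{\tilde M(n),\ n\in\mathbb{N}\}$ is a discrete-time Markov chain and $N$ is an independent Poisson process of intensity $\lambda$ with inter-arrival times $\{W_k\}$; $\sigma$ is independent of $(\tilde M,N)$. The waiting times of $M$ are the $W_k$. The inverse is $\psi(t):=\inf\{s\in\mathbb{R}_+ : \sigma(s)>t\}$. The waiting times $J_k$ of $Y$ are the successive inter-arrival times of the counting process $N(\psi(t))$, i.e. $Y(t)=\tilde M(n)$ for $\sum_{k=1}^nJ_k\le t<\sum_{k=1}^{n+1}J_k$. The identity for $J_{n+1}$ is understood almost surely; $\sigma(T_n^-)$ is the left limit of $\sigma$ at $T_n$, with $\sigma(0^-):=\sigma(0)=0$. Matrices: $I_n$ is the $n\times n$ identity; $K_n$ is the lower shift matrix, $(K_n)_{ij}=1$ if $i=j+1$ and $0$ otherwise; $A_n:=I_n-K_n$; $B_n$ is the $n\times n$ lower triangular matrix with all entries on and below the main diagonal equal to $1$. For $\boldsymbol{t}_n=(t_1,\dots,t_n)$, $\boldsymbol{\sigma}(\boldsymbol{t}_n):=(\sigma(t_1),\dots,\sigma(t_n))^T$. *)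

(* Defs.v *)
From HB Require Import structures.
From mathcomp Require Import all_boot all_order all_algebra.
From mathcomp Require Import complex.
From mathcomp Require Import all_classical all_reals all_analysis measurable_realfun.

Set Implicit Arguments.
Unset Strict Implicit.
Unset Printing Implicit Defensive.

Import Order.TTheory GRing.Theory Num.Theory.
Import numFieldNormedType.Exports.

Local Open Scope classical_set_scope.
Local Open Scope ring_scope.

Section lebesgue_tuple.
Context {R : realType}.

Definition tcons n (x : measurableTypeR R * n.-tuple R) : n.+1.-tuple R :=
  [the n.+1.-tuple R of (x.1 : R) :: x.2].

Lemma measurable_tcons n : measurable_fun setT (@tcons n).
Proof.
by apply: measurable_cons.
Qed.

Section step.
Variables (n : nat) (nu : {sigma_finite_measure set (n.-tuple R) -> \bar R}).

Definition lebesgue_cons : set (n.+1.-tuple R) -> \bar R :=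
  pushforward (lebesgue_measure \x nu)%E (@tcons n).

Let lebesgue_cons0 : lebesgue_cons set0 = 0%E.
Proof. by rewrite /lebesgue_cons /pushforward preimage_set0 measure0. Qed.

Let lebesgue_cons_ge0 A : (0 <= lebesgue_cons A)%E.
Proof. by rewrite /lebesgue_cons /pushforward measure_ge0. Qed.

Let lebesgue_cons_sigma_additive : semi_sigma_additive lebesgue_cons.
Proof.
have mtcons A : measurable A -> measurable (@tcons n @^-1` A).
  by move=> mA; rewrite -[X in measurable X]setTI; exact: measurable_tcons.
move=> F mF tF mUF; rewrite /lebesgue_cons /pushforward preimage_bigcup.
apply: measure_semi_sigma_additive.
- by move=> k; exact: mtcons.
- apply/trivIsetP => /= i j _ _ ij; rewrite -preimage_setI.
  by move/trivIsetP : tF => /(_ _ _ _ _ ij) ->//; rewrite preimage_set0.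
- by rewrite -preimage_bigcup; exact: mtcons.
Qed.

HB.instance Definition _ := isMeasure.Build _ _ _ lebesgue_cons
  lebesgue_cons0 lebesgue_cons_ge0 lebesgue_cons_sigma_additive.

Let lebesgue_cons_sigma_finite : sigma_finite setT lebesgue_cons.
Proof.
pose mu : {sigma_finite_measure set (measurableTypeR R) -> \bar R} :=
  lebesgue_measure.
have /sigma_finiteP[F [TF ndF Foo]] := sigma_finiteT mu.
have /sigma_finiteP[G [TG ndG Goo]] := sigma_finiteT nu.
pose g (t : n.+1.-tuple R) : measurableTypeR R * n.-tuple R :=
  (tnth t ord0, [tuple of behead t]).
have gK : cancel (@tcons n) g.
  by move=> [x t]; rewrite /g/= (tnth_nth 0)/=; congr pair; apply: val_inj.
have mg : measurable_fun setT g.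
  apply: measurable_fun_pair; first exact: (@measurable_tnth _ R _ ord0).
  exact: measurable_behead.
exists (fun k => g @^-1` (F k `*` G k)).
  rewrite -preimage_bigcup; apply/esym/seteqP; split => // t _.
  have [k _ Fk] : (\bigcup_k F k) (g t).1 by rewrite -TF.
  have [l _ Gl] : (\bigcup_k G k) (g t).2 by rewrite -TG.
  exists (maxn k l) => //; split.
  - by move: Fk; exact/subsetPset/ndF/leq_maxl.
  - by move: Gl; exact/subsetPset/ndG/leq_maxr.
move=> k; have [mF Fk] := Foo k; have [mG Gk] := Goo k; split.
  by rewrite -[X in measurable X]setTI; apply: mg => //; exact: measurableX.
rewrite /lebesgue_cons /pushforward -comp_preimage.
rewrite (_ : g \o @tcons n = idfun); last by apply/funext => x; exact: gK.
rewrite preimage_id product_measure1E// lte_mul_pinfty// ge0_fin_numE//.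
Qed.

HB.instance Definition _ :=
  @Measure_isSigmaFinite.Build _ _ _ lebesgue_cons lebesgue_cons_sigma_finite.

End step.

(* Lebesgue measure on R^n, as the iterated product of [lebesgue_measure]. *)
Fixpoint lebesgue_tuple (n : nat) :
    {sigma_finite_measure set (n.-tuple R) -> \bar R} :=
  match n with
  | 0 => (\d_([tuple] : 0.-tuple R) : {sigma_finite_measure set (0.-tuple R) -> \bar R})
  | m.+1 => lebesgue_cons (lebesgue_tuple m)
  end.

End lebesgue_tuple.

Section independence.
Context d (T : measurableType d) (R : realType) (P : probability T R).

Definition generated_sigma d' (T' : measurableType d') (I : Type) (D : set I)
    (X : I -> T -> T') : set (set T) :=
  <<s \bigcup_(i in D) preimage_set_system setT (X i) measurable >>.

Definition independent_systems (G H : set (set T)) : Prop :=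
  forall A B, G A -> H B -> P (A `&` B) = (P A * P B)%E.

Definition mutually_independent d' (T' : measurableType d')
    (X : nat -> T -> T') : Prop :=
  forall (s : seq nat) (A : nat -> set T'),
    uniq s -> (forall k, measurable (A k)) ->
    P (\bigcap_(k in [set` s]) X k @^-1` A k) =
    (\prod_(k <- s) P (X k @^-1` A k))%E.

Definition markov_chain d' (S : measurableType d') (X : nat -> T -> S) : Prop :=
  exists K : R.-pker S ~> S, forall (n : nat) (A : nat -> set S),
    (forall k, measurable (A k)) ->
    P (\bigcap_(k in `I_n.+2) X k @^-1` A k) =
    (\int[P]_(x in \bigcap_(k in `I_n.+1) X k @^-1` A k) K (X n x) (A n.+1))%E.

End independence.

Section time_change.
Context {T : Type} {R : realType}.
Variables (W : nat -> T -> R) (sigma : R -> T -> R).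

(* Sequences of waiting times are indexed from 0: [W k] is the (k+1)-st one. *)
Definition jump_time (n : nat) (x : T) : R := \sum_(k < n) W k x.

(* Time is extended by +oo, where [counting_process] is +oo, because
   [inverse_process] takes the value +oo beyond the range of a bounded path. *)
Definition counting_process (s : \bar R) (x : T) : \bar R :=
  ereal_sup [set n%:R%:E | n in [set n | ((jump_time n x)%:E <= s)%E]].

Definition inverse_process (t : R) (x : T) : \bar R :=
  ereal_inf [set s%:E | s in [set s | 0 <= s /\ t < sigma s x]].

Definition arrival_time (X : R -> T -> \bar R) (n : nat) (x : T) : \bar R :=
  ereal_inf [set t%:E | t in [set t | 0 <= t /\ (n%:R%:E <= X t x)%E]].

Definition interarrival_time (X : R -> T -> \bar R) (k : nat) (x : T) : R :=
  fine (arrival_time X k.+1 x) - fine (arrival_time X k x).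

Definition waiting_time : nat -> T -> R :=
  interarrival_time (fun t x => counting_process (inverse_process t x) x).

Variables (S : Type) (Mt : nat -> T -> S).

(* When [counting_process s x] is infinite the value is the dummy [Mt 0 x]. *)
Definition chain (s : \bar R) (x : T) : S :=
  Mt (Num.truncn (fine (counting_process s x))) x.

Definition time_changed_chain (t : R) (x : T) : S := chain (inverse_process t x) x.

End time_change.

(* Convention at the left end point of the time axis: f(0-) = f(0). *)
Definition left_limit (R : realType) (f : R -> R) (t : R) : R :=
  if t == 0 then f 0 else lim (f s @[s --> t^'-]).

Section characteristic_function.
Context {R : realType}.

Definition expi (a : R) : R[i] := Complex (cos a) (sin a).

Definition complex_integral d (T : measurableType d)
    (mu : {measure set T -> \bar R}) (D : set T) (f : T -> R[i]) : R[i] :=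
  Complex (\int[mu]_(x in D) complex.Re (f x))
          (\int[mu]_(x in D) complex.Im (f x)).

Definition dotv n (u v : 'cV[R]_n) : R := \sum_i u i 0 * v i 0.

Definition char_fun d (T : measurableType d) (P : probability T R) n
    (X : T -> 'cV[R]_n) (xi : 'cV[R]_n) : R[i] :=
  complex_integral P setT (fun x => expi (dotv xi (X x))).

Definition shift_mx n : 'M[R]_n :=
  \matrix_(i, j) (if (i == j.+1 :> nat) then 1 else 0).

Definition diff_mx n : 'M[R]_n := 1%:M - shift_mx n.

Definition lower_ones_mx n : 'M[R]_n :=
  \matrix_(i, j) (if (j <= i)%N then 1 else 0).

Definition col_of_tuple n (w : n.-tuple R) : 'cV[R]_n := \col_i tnth w i.

Definition sample T n (sigma : R -> T -> R) (t : 'cV[R]_n) (x : T) : 'cV[R]_n :=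
  \col_i sigma (t i 0) x.

Definition nonneg_orthant n : set (n.-tuple R) :=
  [set w | forall i, 0 <= tnth w i].

End characteristic_function.

(* Main.v *)
Require Import Defs.
From HB Require Import structures.
From mathcomp Require Import all_boot all_order all_algebra.
From mathcomp Require Import complex.
From mathcomp Require Import all_classical all_reals all_analysis measurable_realfun.

(* On the almost sure event where the [W k] are positive and [sigma] is strictly
   increasing, [T_n <= psi t] holds exactly when [sigma s <= t] for every
   [s < T_n]; hence the [n]-th arrival of [N (psi t)] is [sup_(s < T_n) sigma s],
   that is [sigma (T_n -)]. The jump times are measurable with respect to the
   counting process, so [sigma] is independent of [(W_0, ..., W_(n - 1))]; by
   Fubini and the absence of fixed jumps, [sigma] is almost surely continuous at
   each [T_n] with [0 < n]. Therefore [J_n = A_n sigma(B_n W)] almost surely, and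
   the formula follows by integrating first over [sigma] and then over the law
   of [(W_0, ..., W_(n - 1))], which has density
   [lambda ^+ n * expR (- lambda * sum w)] on the nonnegative orthant. *)

Set Implicit Arguments.
Unset Strict Implicit.
Unset Printing Implicit Defensive.

Import Order.TTheory GRing.Theory Num.Theory.
Import numFieldNormedType.Exports.

Local Open Scope classical_set_scope.
Local Open Scope ring_scope.

(** * Independence and laws of tuples *)

Section density.
Local Open Scope ereal_scope.
Context d (T : measurableType d) (R : realType).

(** Integrals over all measurable sets determine a density almost everywhere, so [p] may replace the
    Radon-Nikodym derivative of [nu] in the change of variables formula. *)
Lemma ge0_integral_density (nu : {finite_measure set T -> \bar R})
    (mu : {sigma_finite_measure set T -> \bar R}) (p f : T -> \bar R) :
  measurable_fun setT p -> (forall x, 0 <= p x) ->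
  (forall A, measurable A -> nu A = \int[mu]_(x in A) p x) ->
  measurable_fun setT f -> (forall x, 0 <= f x) ->
  \int[nu]_x f x = \int[mu]_x (f x * p x).
Proof.
move=> mp p0 nuE mf f0.
have numu : nu `<< mu.
  apply/null_content_dominatesP => A mA muA0; rewrite nuE//.
  by apply: null_set_integral => //; exact: measurable_funTS.
pose g := Radon_Nikodym_SigmaFinite.f nu mu.
have mg : measurable_fun setT g.
  exact: measurable_int (Radon_Nikodym_SigmaFinite.f_integrable numu).
rewrite -(Radon_Nikodym_SigmaFinite.change_of_variables numu)//.
apply: ae_eq_integral => //; [exact: emeasurable_funM..|].
apply: ae_eqe_mul2l; apply: integral_ae_eq => //.
  exact: Radon_Nikodym_SigmaFinite.f_integrable.
by move=> A _ mA; rewrite -nuE// -Radon_Nikodym_SigmaFinite.f_integral.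
Qed.

End density.

Section product_probability.
Context d1 d2 (T1 : measurableType d1) (T2 : measurableType d2) (R : realType).
Variables (P1 : probability T1 R) (P2 : probability T2 R).

Definition product_probability : set (T1 * T2) -> \bar R := (P1 \x P2)%E.

HB.instance Definition _ := Measure.on product_probability.

Let product_probability_setT : product_probability setT = 1%E.
Proof.
by rewrite /product_probability -setXTT product_measure1E//= !probability_setT mule1.
Qed.

HB.instance Definition _ := Measure_isProbability.Build _ _ _
  product_probability product_probability_setT.

End product_probability.

Section independent_of_sigma_algebra.
Local Open Scope ereal_scope.
Context d d' (T : measurableType d) (E : measurableType d') (R : realType).
Variables (P : probability T R) (G : set (set T)) (V : T -> E).
Hypothesis sGm : <<s G >> `<=` measurable.
Hypothesis mV : measurable_fun setT V.
Hypothesis indep : forall A B, <<s G >> A -> measurable B ->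
  P (A `&` V @^-1` B) = P A * P (V @^-1` B).

Local Notation TG := (g_sigma_algebraType G).

(** The sample point itself, seen through the coarser sigma-algebra [<<s G>>], acts as a random
    variable independent of [V]. A whole process is thus handled without a path space. *)
Lemma measurable_to_coarser : measurable_fun setT (id : T -> TG).
Proof. by move=> _ A mA; rewrite setTI; exact: sGm. Qed.

Lemma measurable_fun_coarser d2 (U : measurableType d2) (f : TG -> U) :
  measurable_fun setT f -> measurable_fun setT (f : T -> U).
Proof. by move=> mf; exact: (measurableT_comp mf measurable_to_coarser). Qed.

Lemma measurable_with_id : measurable_fun setT (fun x => (V x, x) : E * TG).
Proof. exact/measurable_fun_pair/measurable_to_coarser. Qed.

Let idG : {mfun T >-> TG} := HB.pack (id : T -> TG)
  (isMeasurableFun.Build _ _ _ _ _ measurable_to_coarser).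
Let VG : {mfun T >-> (E * TG)%type} := HB.pack (fun x => (V x, x) : E * TG)
  (isMeasurableFun.Build _ _ _ _ _ measurable_with_id).
Let mfV : {mfun T >-> E} := HB.pack V (isMeasurableFun.Build _ _ _ _ _ mV).

Lemma measurable_integral_coarser (F : E * TG -> \bar R) :
  measurable_fun setT F -> (forall z, 0 <= F z) ->
  measurable_fun setT (fun v => \int[P]_x F (v, x)).
Proof.
move=> mF F0.
have mFF := @measurable_fun_fubini_tonelli_F _ _ E TG R (distribution P idG) F mF F0.
rewrite (_ : (fun v => _) = fubini_F (distribution P idG) F)//.
apply/funext => v; rewrite /fubini_F ge0_integral_distribution//.
exact: (measurable_fun_pair2 v mF).
Qed.

(** By independence the law of [(V, id)] agrees with the product of the marginal laws on rectangles,
    hence everywhere; Tonelli's theorem then freezes the value of [V]. *)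
Lemma ge0_integral_independent (F : E * TG -> \bar R) :
  measurable_fun setT F -> (forall z, 0 <= F z) ->
  \int[P]_x F (V x, x) = \int[P]_y \int[P]_x F (V y, x).
Proof.
move=> mF F0.
transitivity (\int[distribution P mfV]_v \int[P]_x F (v, x)); last first.
  rewrite ge0_integral_distribution//; first exact: measurable_integral_coarser.
  by move=> v; apply: integral_ge0.
have law : forall X, measurable X ->
    (distribution P mfV \x distribution P idG) X = distribution P VG X.
  apply: product_measure_unique => A B mA mB.
  transitivity (P (B `&` V @^-1` A)); last by rewrite indep// muleC.
  by congr (P _); apply/seteqP; split => [x []|x []].
transitivity (\int[distribution P VG]_z F z).
  by rewrite ge0_integral_distribution.
transitivity (\int[distribution P mfV \x distribution P idG]_z F z).
  by apply: eq_measure_integral => X mX _; exact/esym/law.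
rewrite fubini_tonelli1//; apply: eq_integral => v _.
rewrite /fubini_F ge0_integral_distribution//.
exact: measurable_fun_pair2.
Qed.

(** The previous identity for the indicator of [D] makes the probability the mean of the section
    probabilities. These vanish off [N], a set that [V] almost surely avoids. *)
Lemma negligible_independent (D : set (E * TG)) (N : set E) :
  measurable D -> measurable N -> P (V @^-1` N) = 0 ->
  (forall v, ~ N v -> P (xsection D v) = 0) ->
  P [set x | D (V x, x)] = 0.
Proof.
move=> mD mN PN0 D0.
have m1D : measurable_fun setT (fun z : E * TG => (\1_D z)%:E : \bar R).
  exact/measurable_EFinP/measurable_indic.
have D1_ge0 z : 0 <= (\1_D z)%:E :> \bar R by rewrite lee_fin.
have := ge0_integral_independent m1D D1_ge0.
have mDV : measurable [set x | D (V x, x)].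
  by have := measurable_with_id measurableT mD; rewrite setTI.
have -> : \int[P]_x (\1_D (V x, x))%:E = P [set x | D (V x, x)].
  rewrite (_ : (fun x => _) = (fun x => (\1_[set x | D (V x, x)] x)%:E)).
    by rewrite integral_indic// setIT.
  by apply/funext => x; rewrite !indicE; congr (_ _)%:R%:E; apply/idP/idP; rewrite !inE.
move=> ->.
have sec v : \int[P]_x (\1_D (v, x))%:E = P (xsection D v).
  rewrite (_ : (fun x => _) = (fun x => (\1_(xsection D v) x)%:E)).
    rewrite integral_indic// ?setIT//; apply: sGm.
    exact: (@measurable_xsection _ _ E TG).
  by apply/funext => x; rewrite !indicE mem_xsection.
under eq_integral do rewrite sec.
transitivity (\int[P]_(y in V @^-1` N) P (xsection D (V y))).
  rewrite [RHS]integral_mkcond; apply: eq_integral => y _.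
  rewrite patchE; case: ifPn => //; rewrite notin_setE => Ny.
  exact: D0.
apply: null_set_integral => //.
  by rewrite -[X in measurable X]setTI; exact: mV.
apply: measurable_funTS.
rewrite (_ : (fun y => _) = (fun v => \int[P]_x (\1_D (v, x))%:E) \o V).
  exact: (measurableT_comp (measurable_integral_coarser m1D D1_ge0) mV).
by apply/funext => y /=; rewrite sec.
Qed.

End independent_of_sigma_algebra.

(** * Boxes and product laws on tuples *)

Section boxes.
Context {R : realType}.

(** Sides are indexed by [nat], as in [mutually_independent], so that removing the first coordinate
    is a mere shift of [A]. *)
Definition box n (A : nat -> set R) : set (n.-tuple R) :=
  [set w | forall i : 'I_n, A i (tnth w i)].

Lemma boxE n (A : nat -> set R) :
  box A = \big[setI/setT]_(i < n) ((@tnth n R ^~ i) @^-1` A i).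
Proof.
rewrite -bigcap_seq; apply/seteqP; split => [w Aw i _|w Aw i]; first exact: Aw.
by apply: Aw; rewrite /= mem_index_enum.
Qed.

Lemma measurable_box n (A : nat -> set R) :
  (forall k, measurable (A k)) -> measurable (box A : set (n.-tuple R)).
Proof.
move=> mA; rewrite boxE; apply: bigsetI_measurable => i _.
by rewrite -[X in measurable X]setTI; apply: measurable_tnth.
Qed.

Lemma box_tcons n (A : nat -> set R) :
  @tcons R n @^-1` box A = A 0%N `*` box (fun k => A k.+1).
Proof.
apply/seteqP; split => [[x w] /= Aw|[x w] /= [Ax Aw] i].
  split; first exact: (Aw ord0).
  by move=> i; have := Aw (lift ord0 i); rewrite tnthS.
by have [j ->|->//] := unliftP ord0 i; rewrite tnthS; exact: Aw.
Qed.

Lemma measurable_nonneg_orthant n : measurable (@nonneg_orthant R n).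
Proof.
rewrite (_ : @nonneg_orthant R n = box (fun=> `[0, +oo[%classic)); last first.
  by apply/seteqP; split => w w0 i; have := w0 i; rewrite /= in_itv/= andbT.
by apply: measurable_box => k; exact: measurable_itv.
Qed.

Lemma measurable_tuple_boxes n :
  @measurable _ (n.-tuple R) =
  <<s [set @box n A | A in [set A : nat -> set R | forall k, measurable (A k)]] >>.
Proof.
apply/seteqP; split; last first.
  apply: smallest_sub; first exact: sigma_algebra_measurable.
  by move=> _ [A mA <-]; exact: measurable_box.
apply: smallest_sub; first exact: smallest_sigma_algebra.
rewrite -bigcup_seq; apply: bigcup_sub => i _ _ [B mB <-].
apply: sub_sigma_algebra.
exists (fun k => if k == i :> nat then B else setT).
  by move=> k /=; case: ifPn.
apply/seteqP; split => [w /= /(_ i)|w [_ Bw] j /=]; first by rewrite eqxx.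
by case: ifPn => // /eqP/val_inj ->.
Qed.

(** Boxes generate the sigma-algebra, are stable under intersection, and include the whole space,
    which has finite mass. *)
Lemma measure_box_unique n (m1 m2 : {finite_measure set (n.-tuple R) -> \bar R}) :
  (forall A : nat -> set R, (forall k, measurable (A k)) ->
    m1 (box A) = m2 (box A)) ->
  forall X, measurable X -> m1 X = m2 X.
Proof.
move=> m12 X mX.
apply: (measure_unique
  [set @box n A | A in [set A : nat -> set R | forall k, measurable (A k)]]
  (fun=> setT)) => //.
- exact: measurable_tuple_boxes.
- move=> _ _ [A mA <-] [B mB <-]; exists (fun k => A k `&` B k).
    by move=> k; exact: measurableI.
  by apply/seteqP; split => [w AB|w [Aw Bw] i //];
    split => i; have [] := AB i.
- by move=> _; exists (fun=> setT) => //; apply/seteqP; split.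
- by rewrite bigcup_const.
- by move=> _ [A mA <-]; exact: m12.
- by move=> _; rewrite -ge0_fin_numE// fin_num_measure.
Qed.

End boxes.

Section iid_tuple.
Local Open Scope ereal_scope.
Context {R : realType}.
Variable Q : probability (measurableTypeR R) R.

Let mtcons n : {mfun (measurableTypeR R * n.-tuple R)%type >-> n.+1.-tuple R} :=
  HB.pack (@tcons R n) (isMeasurableFun.Build _ _ _ _ _ (@measurable_tcons R n)).

(** The product law of [n] copies of [Q], built by the same recursion as [lebesgue_tuple] so that
    both can be compared by induction. *)
Fixpoint iid_tuple (n : nat) : probability (n.-tuple R) R :=
  match n with
  | 0 => \d_([tuple] : 0.-tuple R)
  | m.+1 => distribution (product_probability Q (iid_tuple m)) (mtcons m)
  end.

Lemma iid_tuple_box n (A : nat -> set R) : (forall k, measurable (A k)) ->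
  iid_tuple n (box A) = \prod_(i < n) Q (A i).
Proof.
elim: n A => [|n IH] A mA.
  by rewrite big_ord0 /= diracE mem_set// => -[].
rewrite big_ord_recl -(IH (fun k => A k.+1))//=.
rewrite /distribution /pushforward/= box_tcons.
rewrite /product_probability product_measure1E//.
- exact: (mA 0%N).
- by apply: measurable_box => k; exact: mA.
Qed.

Variable p : R -> R.
Hypothesis mp : measurable_fun setT p.
Hypothesis p_ge0 : forall x, (0 <= p x)%R.
Hypothesis Qp : forall A : set R, measurable A ->
  Q A = \int[lebesgue_measure]_(x in A) (p x)%:E.

(** Tonelli's theorem makes the first coordinate the inner integral on both sides. The induction
    hypothesis treats the outer integral, the density of [Q] the inner one. *)
Lemma ge0_integral_iid_tuple n (f : n.-tuple R -> \bar R) :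
  measurable_fun setT f -> (forall w, 0 <= f w) ->
  \int[iid_tuple n]_w f w =
  \int[lebesgue_tuple n]_w (f w * (\prod_(i < n) p (tnth w i))%R%:E).
Proof.
elim: n f => [|n IH] f mf f0.
  have -> : (fun w : 0.-tuple R => f w * (\prod_(i < 0) p (tnth w i))%R%:E) = f.
    by apply/funext => w; rewrite big_ord0 mule1.
  by [].
have mfc : measurable_fun setT (f \o @tcons R n).
  exact: (measurableT_comp mf (@measurable_tcons R n)).
have mprod m : measurable_fun setT
    (fun w : m.-tuple R => (\prod_(i < m) p (tnth w i))%R%:E).
  apply/measurable_EFinP; apply: measurable_prod => i _.
  by apply: measurableT_comp => //; exact: measurable_tnth.
have prod_ge0 m (w : m.-tuple R) : 0 <= (\prod_(i < m) p (tnth w i))%R%:E.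
  by rewrite lee_fin; apply: prodr_ge0 => i _.
rewrite /= ge0_integral_distribution// fubini_tonelli2//; last first.
  by move=> z; exact: f0.
rewrite [LHS]IH; last 2 first.
- by apply: measurable_fun_fubini_tonelli_G => // z; exact: f0.
- by move=> w; apply: integral_ge0 => x _; exact: f0.
have mF : measurable_fun setT
    (fun w : n.+1.-tuple R => f w * (\prod_(i < n.+1) p (tnth w i))%R%:E).
  by apply: emeasurable_funM => //; exact: mprod.
have F0 w : 0 <= f w * (\prod_(i < n.+1) p (tnth w i))%R%:E.
  by apply: mule_ge0 => //; exact: prod_ge0.
rewrite /lebesgue_cons ge0_integral_pushforward//; last exact: measurable_tcons.
have mFc := measurableT_comp mF (@measurable_tcons R n).
rewrite preimage_setT fubini_tonelli2//; last by move=> z; exact: F0.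
apply: eq_integral => w _; rewrite /fubini_G.
have mfw : measurable_fun setT (fun x : measurableTypeR R => f (tcons (x, w))).
  exact: (measurable_fun_pair1 w mfc).
have mpE : measurable_fun setT (fun x : measurableTypeR R => (p x)%:E).
  exact/measurable_EFinP.
have pE_ge0 x : 0 <= (p x)%:E by rewrite lee_fin.
transitivity (\int[Q]_x f (tcons (x, w)) * (\prod_(i < n) p (tnth w i))%R%:E).
  by [].
rewrite (ge0_integral_density mpE pE_ge0 Qp mfw)//.
rewrite -ge0_integralZr//; last 2 first.
- exact: emeasurable_funM.
- by move=> x _; rewrite mule_ge0.
apply: eq_integral => x _.
rewrite /= big_ord_recl EFinM muleA; congr (_ * _%:E).
by apply: eq_bigr => i _; rewrite tnthS.
Qed.

End iid_tuple.

(** * Joint law of the exponential waiting times *)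

Section exponential_waiting_times.
Context d (T : measurableType d) (R : realType) (P : probability T R).
Variables (lambda : R) (W : nat -> {RV P >-> R}).
Hypothesis lambda_gt0 : 0 < lambda.
Hypothesis W_exp : forall (k : nat) (A : set R), measurable A ->
  distribution P (W k) A = exponential_prob lambda A.
Hypothesis W_indep : mutually_independent P W.

Definition wtuple n (x : T) : n.-tuple R := [tuple W i x | i < n].

Lemma measurable_wtuple n : measurable_fun setT (wtuple n).
Proof.
apply/measurable_fun_tnthP => i.
rewrite (_ : _ \o _ = W i)//.
by apply/funext => x /=; rewrite tnth_mktuple.
Qed.

Let wt n : {mfun T >-> n.-tuple R} :=
  HB.pack (wtuple n) (isMeasurableFun.Build _ _ _ _ _ (@measurable_wtuple n)).

Let measurable_waiting0 : measurable_fun setT (W 0%N : T -> measurableTypeR R).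
Proof. by move=> mT A mA; exact: (measurable_funP (W 0%N)). Qed.

Let W0 : {mfun T >-> measurableTypeR R} :=
  HB.pack (W 0%N : T -> measurableTypeR R)
    (isMeasurableFun.Build _ _ _ _ _ measurable_waiting0).

(** All waiting times share one law, represented here by that of [W 0]. *)
Let Q : probability (measurableTypeR R) R := distribution P W0.

Let QE (A : set R) : measurable A -> Q A = exponential_prob lambda A.
Proof. by move=> mA; rewrite -(W_exp 0%N). Qed.

Lemma distribution_wtuple n (X : set (n.-tuple R)) : measurable X ->
  distribution P (wt n) X = iid_tuple Q n X.
Proof.
apply: measure_box_unique => A mA.
transitivity (\prod_(i < n) Q (A i))%E; last exact/esym/iid_tuple_box.
rewrite /distribution /pushforward/=.
transitivity (P (\bigcap_(k in [set` iota 0 n]) W k @^-1` A k)).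
  congr (P _); apply/seteqP; split => [x Ax k|x Ax i /=].
    rewrite /= mem_iota/= => kn; have := Ax (Ordinal kn).
    by rewrite tnth_mktuple.
  by rewrite tnth_mktuple; apply: Ax; rewrite /= mem_iota/=.
rewrite W_indep ?iota_uniq//.
rewrite -{1}(subn0 n) -/(index_iota 0 n) big_mkord; apply: eq_bigr => i _.
by rewrite QE// -(W_exp i).
Qed.
Lemma ge0_integral_wtuple n (f : n.-tuple R -> \bar R) :
  measurable_fun setT f -> (forall w, 0 <= f w)%E ->
  (\int[P]_x f (wtuple n x) =
  \int[lebesgue_tuple n]_(w in @nonneg_orthant R n)
    (f w * (lambda ^+ n * expR (- lambda * \sum_(j < n) tnth w j))%:E))%E.
Proof.
move=> mf f0.
transitivity (\int[distribution P (wt n)]_w f w)%E.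
  by rewrite ge0_integral_distribution.
transitivity (\int[iid_tuple Q n]_w f w)%E.
  by apply: eq_measure_integral => X mX _; exact: distribution_wtuple.
rewrite (@ge0_integral_iid_tuple _ _ (exponential_pdf lambda))//; last 2 first.
- exact: measurable_exponential_pdf.
- by move=> x; apply: exponential_pdf_ge0; exact: ltW.
rewrite [RHS]integral_mkcond; apply: eq_integral => w _.
rewrite patchE; case: ifPn => [/[!inE] w0|].
  congr (_ * _%:E)%E.
  rewrite mulr_sumr expR_sum -[X in _ ^+ X]card_ord -prodr_const -big_split/=.
  by apply: eq_bigr => i _; rewrite exponential_pdfE.
(* Off the orthant some coordinate is negative, and its factor in the product density is 0. *)
rewrite notin_setE => /existsNP[i /negP]; rewrite -ltNge => wi0.
by rewrite (bigD1 i)//= lt0_exponential_pdf// mul0r mule0.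
Qed.

End exponential_waiting_times.

(** * Left suprema of right-continuous processes *)

Section right_continuous_process.
Context d (Z : measurableType d) (R : realType).

Lemma measurable_fun_nat_indexed d' (U : measurableType d') (N : Z -> nat)
    (g : nat -> Z -> U) :
  (forall k, measurable (N @^-1` [set k])) ->
  (forall k, measurable_fun setT (g k)) ->
  measurable_fun setT (fun z => g (N z) z).
Proof.
move=> mN mg _ A mA; rewrite setTI.
rewrite (_ : _ @^-1` A = \bigcup_k (N @^-1` [set k] `&` g k @^-1` A)).
  apply: bigcup_measurable => k _; apply: measurableI => //.
  by rewrite -[X in measurable X]setTI; exact: mg.
by apply/seteqP; split => [z Az|z [k _ [<-]]//]; exists (N z).
Qed.

Lemma measurable_truncn_preimage (f : Z -> R) (k : nat) :
  measurable_fun setT f -> (forall z, 0 <= f z) ->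
  measurable ((fun z => Num.truncn (f z)) @^-1` [set k]).
Proof.
move=> mf f0; rewrite (_ : _ @^-1` _ = f @^-1` `[k%:R, k.+1%:R[%classic).
  by rewrite -[X in measurable X]setTI; apply: mf.
apply/seteqP; split => z /=; rewrite in_itv/= -truncn_eq//.
  by move=> ->.
by move/eqP.
Qed.

(* A right-continuous process is the limit of its values at the first point of
   the grid [(m + 1)^-1 N] strictly after the current time. *)
Lemma measurable_right_continuous_at (X : R -> Z -> R) (tau : Z -> R) :
  (forall t, 0 <= t -> measurable_fun setT (X t)) ->
  (forall z t, 0 <= t -> X s z @[s --> t^'+] --> X t z) ->
  measurable_fun setT tau -> (forall z, 0 <= tau z) ->
  measurable_fun setT (fun z => X (tau z) z).
Proof.
move=> mX rcX mtau tau0.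
pose grid (m : nat) (t : R) : R := (Num.truncn (m.+1%:R * t)).+1%:R / m.+1%:R.
have gridP m t : 0 <= t -> t < grid m t <= t + m.+1%:R^-1.
  move=> t0; have /andP[lo hi] := truncn_itv (mulr_ge0 (ler0n R m.+1) t0).
  rewrite /grid ltr_pdivlMr// mulrC hi/= ler_pdivrMr// mulrDl mulVf//.
  by rewrite -(natr1 (Num.truncn _)) lerD2r [leRHS]mulrC.
have mgrid m : measurable_fun setT (fun z => X (grid m (tau z)) z).
  apply: (measurable_fun_nat_indexed (N := fun z => Num.truncn (m.+1%:R * tau z))
    (g := fun k z => X (k.+1%:R / m.+1%:R) z)) => k.
    apply: measurable_truncn_preimage; first exact: measurable_funM.
    by move=> z; rewrite mulr_ge0.
  by apply: mX; rewrite divr_ge0.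
apply: (measurable_fun_cvg mgrid) => z _.
(* Grid points lie strictly after [tau z], so the right limit can be taken along them. *)
have /cvg_at_rightP := rcX z _ (tau0 z); apply; split=> [m|].
  by have /andP[] := gridP m _ (tau0 z).
apply: (@squeeze_cvgr _ _ _ _ (cst (tau z)) (fun m => tau z + m.+1%:R^-1)).
- by near=> m; have /andP[/ltW -> ->] := gridP m _ (tau0 z).
- exact: cvg_cst.
- rewrite -[X in _ --> X]addr0; apply: cvgD; first exact: cvg_cst.
  exact: cvg_harmonic.
Unshelve. all: by end_near. Qed.

End right_continuous_process.

Section left_supremum.
Context {R : realType}.

(** An enumeration of the nonnegative rationals, with repetitions; codes of no rational give 0. *)
Definition nonneg_rat (k : nat) : R :=
  if unpickle k is Some r then `|ratr (r : rat)| else 0.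

Lemma nonneg_rat_ge0 k : 0 <= nonneg_rat k.
Proof. by rewrite /nonneg_rat; case: unpickle. Qed.

Lemma nonneg_rat_dense (a b : R) : 0 <= a -> a < b ->
  exists k, a < nonneg_rat k < b.
Proof.
move=> a0 /rat_in_itvoo[q]; rewrite in_itv/= => /andP[aq qb].
exists (pickle q); rewrite /nonneg_rat pickleK ger0_norm ?aq//.
exact: le_trans a0 (ltW aq).
Qed.

(* Equal to [f (t -)] for [0 < t] when [f] is nondecreasing and nonnegative on
   [0, +oo[; only rational times are used, to keep it measurable in [(f, t)]. *)
Definition left_sup (f : R -> R) (t : R) : \bar R :=
  esups (fun k => if nonneg_rat k < t then (f (nonneg_rat k))%:E else 0%E) 0.

(** Right-continuity extends a bound from rational to all real times before [t]. The clause on the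
    sign of [c] reflects the default value 0 at indices whose rational is not below [t]. *)
Lemma left_sup_leP (f : R -> R) (t : R) (c : \bar R) :
  (forall s, 0 <= s -> f u @[u --> s^'+] --> f s) ->
  (left_sup f t <= c)%E <->
  (0 <= c)%E /\ forall s, 0 <= s -> s < t -> ((f s)%:E <= c)%E.
Proof.
move=> rcf; split => [/ereal_supP fc|[c0 fc]]; last first.
  apply/ereal_supP => _ [k _ <-] /=.
  by case: ifPn => // kt; apply: fc => //; exact: nonneg_rat_ge0.
have fqc k : nonneg_rat k < t -> ((f (nonneg_rat k))%:E <= c)%E.
  by move=> kt; apply: fc; exists k => //; rewrite kt.
split=> [|s s0 st].
  (* A rational beyond [t] contributes the default value 0, whence [0 <= c]. *)
  have m0 : 0 <= Num.max 0 t by rewrite le_max lexx.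
  have m1 : Num.max 0 t < Num.max 0 t + 1 by rewrite ltrDl.
  have [k /andP[+ _]] := nonneg_rat_dense m0 m1.
  rewrite gt_max => /andP[_ tk]; apply: fc; exists k => //.
  by rewrite ltNge (ltW tk).
case: c fc fqc => [c| |] fc fqc; last 2 first.
- by rewrite leey.
- have [k /andP[sk kt]] := nonneg_rat_dense s0 st.
  by have := fqc _ kt.
(* If [c < f s], then [f] exceeds [c] just after [s], in particular at some rational before [t]. *)
rewrite lee_fin; rewrite leNgt; apply/negP => cfs.
have [e /= e0 He] := (@cvgr_gt _ _ _ _ _ _ (rcf s s0) _ cfs : nbhs _ _).
have lt_s : s < Num.min t (s + e) by rewrite lt_min st ltrDl e0.
have [k] := nonneg_rat_dense s0 lt_s; rewrite lt_min => /and3P[sk kt ke].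
have := fqc _ kt; rewrite lee_fin leNgt => /negP; apply; apply: He => //=.
by rewrite ltr_distlC (lt_trans _ sk) ?ke// ltrBlDr ltrDl.
Qed.

End left_supremum.

(** * Arrival times of the time-changed process *)

Section time_changed_arrivals.
Context {T : Type} {R : realType}.
Variables (W : nat -> T -> R) (sigma : R -> T -> R).
Hypothesis sigma_right_cont : forall (x : T) (t : R), 0 <= t ->
  sigma s x @[s --> t^'+] --> sigma t x.

(** The index [n] may exceed [k] because the jump times of an arbitrary path need not be ordered. *)
Lemma counting_process_geP (k : nat) (s : \bar R) (x : T) : (0 <= s)%E ->
  (k%:R%:E <= counting_process W s x)%E <->
  exists2 n, (k <= n)%N & ((jump_time W n x)%:E <= s)%E.
Proof.
move=> s0; split=> [|[n kn ns]]; last first.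
  apply: le_ereal_sup_tmp; exists n%:R%:E; first by exists n.
  by rewrite lee_fin ler_nat.
case: k => [_|k kN]; first by exists 0%N; rewrite ?/jump_time ?big_ord0.
apply: contrapT => /forall2NP no_jump; move: kN; apply/negP; rewrite -ltNge.
apply: (@le_lt_trans _ _ k%:R%:E); last by rewrite lte_fin ltr_nat.
apply: ge_ereal_sup => _ [n /= ns <-]; rewrite lee_fin ler_nat.
by case: (no_jump n) => // /negP; rewrite -ltnNge.
Qed.

(** Both sides say that [sigma] does not exceed [t] on [[0, c[]. *)
Lemma inverse_process_geP (c t : R) (x : T) : 0 <= t ->
  (c%:E <= inverse_process sigma t x)%E <->
  (left_sup (sigma ^~ x) c <= t%:E)%E.
Proof.
move=> t0; rewrite (left_sup_leP _ _ (@sigma_right_cont x)).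
split=> [/ereal_infP ct|[_ ct]].
  split=> // s s0 sc; rewrite lee_fin leNgt; apply/negP => ts.
  have /ct : [set s%:E | s in [set s | 0 <= s /\ t < sigma s x]] s%:E by exists s.
  by rewrite lee_fin leNgt sc.
apply/ereal_infP => _ [s [s0 ts] <-]; rewrite lee_fin leNgt; apply/negP => sc.
by have := ct _ s0 sc; rewrite lee_fin leNgt ts.
Qed.

Lemma inverse_process_ge0 (t : R) (x : T) : (0 <= inverse_process sigma t x)%E.
Proof. by apply/ereal_infP => _ [s [s0 _] <-]; rewrite lee_fin. Qed.

(** By the two equivalences above, the count has reached [k] at time [t] exactly when the left
    supremum at some [T_n] with [k <= n] is at most [t]. Keeping the infimum over [n] makes this
    valid for every [x], as measurability requires. *)
Lemma arrival_time_time_changed (k : nat) (x : T) :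
  arrival_time (fun t x => counting_process W (inverse_process sigma t x) x) k x =
  einfs (fun n => left_sup (sigma ^~ x) (jump_time W n x)) k.
Proof.
have geP t : 0 <= t ->
    (k%:R%:E <= counting_process W (inverse_process sigma t x) x)%E <->
    exists2 n, (k <= n)%N & (left_sup (sigma ^~ x) (jump_time W n x) <= t%:E)%E.
  move=> t0; rewrite (counting_process_geP _ _ (inverse_process_ge0 t x)).
  by split => -[n kn /(inverse_process_geP _ _ t0) nt]; exists n.
apply/eqP; rewrite eq_le; apply/andP; split; last first.
  apply/ereal_infP => _ [t [t0 /(geP _ t0)[n kn nt]] <-].
  by apply: le_trans nt; apply: ereal_inf_lbound; exists n.
apply/ereal_infP => _ [n /= kn <-].
have [+ _] := (left_sup_leP (jump_time W n x) _ (@sigma_right_cont x)).1 (lexx _).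
case nE : (left_sup _ _) => [t| |//]; last by rewrite (leey (arrival_time _ _ _)).
rewrite lee_fin => t0; apply: ereal_inf_lbound; exists t => //; split => //.
by apply/(geP _ t0); exists n; rewrite ?nE.
Qed.

End time_changed_arrivals.

Section measurable_waiting_time.
Context d (Z : measurableType d) (R : realType).

Lemma measurable_left_sup (X : R -> Z -> R) (tau : Z -> R) :
  (forall t, 0 <= t -> measurable_fun setT (X t)) -> measurable_fun setT tau ->
  measurable_fun setT (fun z => left_sup (X ^~ z) (tau z)).
Proof.
move=> mX mtau; apply: measurable_fun_esups => k.
apply: measurable_fun_ifT => //; first exact: measurable_fun_ltr.
by apply/measurable_EFinP/mX; exact: nonneg_rat_ge0.
Qed.

Lemma measurable_jump_time (W : nat -> Z -> R) (n : nat) :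
  (forall k, measurable_fun setT (W k)) -> measurable_fun setT (jump_time W n).
Proof. by move=> mW; apply: measurable_sum. Qed.

(** The formula for arrival times replaces an infimum over a continuum of times by countable infima
    and suprema. *)
Lemma measurable_waiting_time (W : nat -> Z -> R) (sigma : R -> Z -> R) (k : nat) :
  (forall x t, 0 <= t -> sigma s x @[s --> t^'+] --> sigma t x) ->
  (forall j, measurable_fun setT (W j)) ->
  (forall t, 0 <= t -> measurable_fun setT (sigma t)) ->
  measurable_fun setT (waiting_time W sigma k).
Proof.
move=> rc mW msigma.
have marrival j : measurable_fun setT (fun x => fine (arrival_time
    (fun t x => counting_process W (inverse_process sigma t x) x) j x)).
  under eq_fun do rewrite (arrival_time_time_changed _ rc).
  apply: (measurableT_comp (fine_measurable measurableT)) => //.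
  apply: measurable_fun_einfs => n; apply: measurable_left_sup => //.
  exact: measurable_jump_time.
exact: measurable_funB.
Qed.

End measurable_waiting_time.

(** * Left limits of increasing paths *)

Section increasing_path.
Context {R : realType}.
Variable f : R -> R.
Hypothesis f_right_cont : forall s, 0 <= s -> f u @[u --> s^'+] --> f s.
Hypothesis f_incr : forall s t, 0 <= s -> s < t -> f s < f t.
Hypothesis f0 : f 0 = 0.

Let f_ge0 s : 0 <= s -> 0 <= f s.
Proof. by rewrite le_eqVlt => /predU1P[<-|/f_incr/ltW]; rewrite f0// => ->. Qed.

Lemma left_sup_ge0 t : (0 <= left_sup f t)%E.
Proof. by have [] := (left_sup_leP t _ f_right_cont).1 (lexx _). Qed.

Lemma left_sup_le_self t : 0 <= t -> (left_sup f t <= (f t)%:E)%E.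
Proof.
move=> t0; apply/(left_sup_leP _ _ f_right_cont); rewrite lee_fin f_ge0//.
by split=> // s s0 st; rewrite lee_fin ltW// f_incr.
Qed.

Lemma left_sup_fin_num t : 0 <= t -> left_sup f t \is a fin_num.
Proof.
move=> t0; rewrite ge0_fin_numE ?left_sup_ge0//.
by rewrite (le_lt_trans (left_sup_le_self t0)) ?ltry.
Qed.

Lemma left_sup0 : left_sup f 0 = 0%E.
Proof.
by apply/eqP; rewrite eq_le left_sup_ge0 andbT -[leRHS]/(0%:E) -{2}f0 left_sup_le_self.
Qed.

Lemma le_left_sup s t : s <= t -> (left_sup f s <= left_sup f t)%E.
Proof.
move=> st; have [t0 ft] := (left_sup_leP t _ f_right_cont).1 (lexx _).
apply/(left_sup_leP _ _ f_right_cont); split => // u u0 us.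
by apply: ft => //; exact: lt_le_trans st.
Qed.

(** Some [f s] with [s < t] comes within [e] of the supremum, and monotonicity keeps later values in
    between. *)
Lemma cvg_left_sup t : 0 < t -> f s @[s --> t^'-] --> fine (left_sup f t).
Proof.
move=> t0; apply/cvgrPdist_lt => e e0.
have LE : left_sup f t = (fine (left_sup f t))%:E.
  by rewrite fineK// left_sup_fin_num// ltW.
have [_ fL] := (left_sup_leP t _ f_right_cont).1 (lexx _).
have [s [s0 st Ls]] : exists s, [/\ 0 <= s, s < t & fine (left_sup f t) - e < f s].
  apply: contrapT => /forallNP no_s.
  (* Otherwise the supremum minus [e] would be an upper bound, nonnegative because [f 0 = 0]. *)
  have fLe s : 0 <= s -> s < t -> f s <= fine (left_sup f t) - e.
    by move=> s0 st; rewrite leNgt; apply/negP => Ls; apply: (no_s s).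
  have : (left_sup f t <= (fine (left_sup f t) - e)%:E)%E.
    apply/(left_sup_leP _ _ f_right_cont).
    split=> [|s s0 st]; rewrite lee_fin; last exact: fLe.
    by have := fLe 0 (lexx _) t0; rewrite f0.
  by rewrite {1}LE lee_fin leNgt ltrBlDr ltrDl e0.
near=> u.
have su : s < u by near: u; exact: nbhs_left_gt.
have ut : u < t by near: u; exact: nbhs_left_lt.
have := fL u (le_trans s0 (ltW su)) ut; rewrite {1}LE lee_fin => fuL.
rewrite ger0_norm ?subr_ge0// ltrBlDr -ltrBlDl.
by rewrite (lt_trans Ls)// f_incr.
Unshelve. all: by end_near. Qed.

(** At 0 the convention for the left limit gives [f 0 = 0], which is also the left supremum
    there. *)
Lemma left_limitE t : 0 <= t -> left_limit f t = fine (left_sup f t).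
Proof.
rewrite le_eqVlt /left_limit => /predU1P[<-|t0]; first by rewrite eqxx f0 left_sup0.
by rewrite gt_eqF//; apply/cvg_lim => //; exact: cvg_left_sup.
Qed.

Lemma left_sup_continuous t : 0 < t -> {for t, continuous f} ->
  left_sup f t = (f t)%:E.
Proof.
move=> t0 ft; rewrite -[LHS]fineK ?left_sup_fin_num ?ltW//; congr EFin.
apply: (cvg_unique _ (cvg_left_sup t0)) => //.
exact: cvg_at_left_filter.
Qed.

End increasing_path.

Section time_changed_path.
Context {T S : Type} {R : realType}.
Variables (W : nat -> T -> R) (sigma : R -> T -> R) (Mt : nat -> T -> S) (x : T).
Hypothesis sigma_right_cont : forall (y : T) (t : R), 0 <= t ->
  sigma s y @[s --> t^'+] --> sigma t y.
Hypothesis sigma_incr : forall s t, 0 <= s -> s < t -> sigma s x < sigma t x.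
Hypothesis sigma0 : sigma 0 x = 0.
Hypothesis W_gt0 : forall k, 0 < W k x.

Lemma jump_time0 : jump_time W 0 x = 0.
Proof. by rewrite /jump_time big_ord0. Qed.

Lemma lt_jump_timeS n : jump_time W n x < jump_time W n.+1 x.
Proof. by rewrite /jump_time big_ord_recr/= ltrDl. Qed.

Lemma le_jump_time m n : (jump_time W m x <= jump_time W n x) = (m <= n)%N.
Proof.
have lt_jt : {homo (fun n => jump_time W n x) : m n / (m < n)%N >-> m < n}.
  exact: (homo_ltn lt_trans lt_jump_timeS).
apply/idP/idP => [|]; last by rewrite leq_eqVlt => /predU1P[->//|/lt_jt/ltW].
by rewrite leNgt; apply: contraNT; rewrite -ltnNge => /lt_jt.
Qed.

Lemma jump_time_ge0 n : 0 <= jump_time W n x.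
Proof. by rewrite -jump_time0 le_jump_time. Qed.

Let L n := left_sup (sigma ^~ x) (jump_time W n x).

(** Positive waiting times order the jump times, so the infimum over [n] is attained at [n = k]. *)
Lemma arrival_time_path k :
  arrival_time (fun t x => counting_process W (inverse_process sigma t x) x) k x =
  L k.
Proof.
rewrite arrival_time_time_changed//; apply/eqP; rewrite eq_le; apply/andP; split.
  by apply: ereal_inf_lbound; exists k => /=.
apply/ereal_infP => _ [n /= kn <-]; apply: (le_left_sup (@sigma_right_cont x)).
by rewrite le_jump_time.
Qed.

Lemma waiting_time_path k : waiting_time W sigma k x = fine (L k.+1) - fine (L k).
Proof. by rewrite /waiting_time /interarrival_time !arrival_time_path. Qed.

Lemma sum_waiting_time n : \sum_(k < n) waiting_time W sigma k x = fine (L n).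
Proof.
under eq_bigr do rewrite waiting_time_path.
rewrite -(big_mkord predT (fun k => fine (L k.+1) - fine (L k))) telescope_sumr//.
by rewrite /L jump_time0 (left_sup0 (@sigma_right_cont x))//= subr0.
Qed.

(** The sums telescope to left suprema, so the hypothesis places [psi t] in [[T_n, T_(n+1)[], where
    the count is [n]. *)
Lemma time_changed_chain_path n t :
  \sum_(k < n) waiting_time W sigma k x <= t <
    \sum_(k < n.+1) waiting_time W sigma k x ->
  time_changed_chain W sigma Mt t x = Mt n x.
Proof.
rewrite !sum_waiting_time => /andP[Ln Ln1].
have Lfin k : L k = (fine (L k))%:E.
  by rewrite fineK// (left_sup_fin_num (@sigma_right_cont x))// jump_time_ge0.
have t0 : 0 <= t.
  by rewrite (le_trans _ Ln)// fine_ge0// (left_sup_ge0 (@sigma_right_cont x)).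
have nt : ((jump_time W n x)%:E <= inverse_process sigma t x)%E.
  by apply/inverse_process_geP => //; rewrite -/(L n) Lfin lee_fin.
have tn : (inverse_process sigma t x < (jump_time W n.+1 x)%:E)%E.
  rewrite ltNge; apply/negP => /(inverse_process_geP sigma_right_cont _ _ t0).
  by rewrite -/(L n.+1) Lfin lee_fin leNgt Ln1.
rewrite /time_changed_chain /chain.
suff -> : counting_process W (inverse_process sigma t x) x = n%:R%:E.
  by rewrite /= natrK.
apply/eqP; rewrite eq_le; apply/andP; split.
  apply/ereal_supP => _ [m /= mt <-]; rewrite lee_fin ler_nat.
  by have := le_lt_trans mt tn; rewrite lte_fin ltNge le_jump_time -ltnNge ltnS.
by apply/ereal_sup_ubound; exists n.
Qed.

End time_changed_path.

(** * Randomness of the time change *)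

Lemma measure_eq_ae d (T : measurableType d) (R : realType)
    (mu : {measure set T -> \bar R}) (A B : set T) :
  measurable A -> measurable B -> {ae mu, forall x, A x <-> B x} ->
  mu A = mu B.
Proof.
move=> mA mB AB; rewrite -[A]setIT -[B]setIT -!integral_indic//.
apply: ge0_ae_eq_integral => //.
- exact/measurable_EFinP/measurable_indic.
- exact/measurable_EFinP/measurable_indic.
apply: filterS AB => x AB _; rewrite !indicE; congr (_%:R%:E).
by congr nat_of_bool; apply/idP/idP; rewrite !inE => /AB.
Qed.

Lemma generated_sigma_measurable d d' (T : measurableType d)
    (T' : measurableType d') (I : Type) (D : set I) (X : I -> T -> T') :
  (forall i, D i -> measurable_fun setT (X i)) ->
  generated_sigma D X `<=` measurable.
Proof.
move=> mX; apply: smallest_sub; first exact: sigma_algebra_measurable.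
by move=> A [i Di [B mB <-]]; exact: mX.
Qed.

Lemma measurable_fun_generated_sigma (T : pointedType) d'
    (T' : measurableType d') (I : Type) (D : set I) (X : I -> T -> T') i :
  D i -> measurable_fun setT
    (X i : g_sigma_algebraType (\bigcup_(i in D)
      preimage_set_system setT (X i) measurable) -> T').
Proof.
by move=> Di _ B mB; apply: sub_sigma_algebra; exists i => //; exists B.
Qed.

Section jump_times_from_counting_process.
Context d (T : measurableType d) (R : realType).
Variable W : nat -> T -> R.

Let N (t : R) : T -> \bar R := counting_process W t%:E.

(* Only rational times enter the infimum, so that this is measurable with
   respect to the sigma-algebra generated by the counting process. *)
Definition jump_time_of_counting (k : nat) (x : T) : \bar R :=
  einfs (fun j => if (k%:R%:E <= N (nonneg_rat j) x)%E
                  then (nonneg_rat j)%:E else +oo%E) 0.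

(** With ordered jump times, the count at [q] is at least [k] exactly when [T_k <= q]; rationals [q]
    approach [T_k] from above. *)
Lemma jump_time_of_countingE k x : (forall j, 0 < W j x) ->
  jump_time_of_counting k x = (jump_time W k x)%:E.
Proof.
move=> W0; have NP q : 0 <= q -> (k%:R%:E <= N q x)%E <-> jump_time W k x <= q.
  move=> q0; rewrite /N counting_process_geP ?lee_fin//.
  split=> [[n kn]|kq]; last by exists k; rewrite ?lee_fin.
  by rewrite lee_fin; apply: le_trans; rewrite le_jump_time.
apply/eqP; rewrite eq_le; apply/andP; split; last first.
  apply/ereal_infP => _ [j _ <-]; case: ifPn => [|_]; last by rewrite leey.
  by move/(NP _ (nonneg_rat_ge0 j)); rewrite lee_fin.
apply/lee_addgt0Pr => e e0.
have [j /andP[kj je]] : exists j, jump_time W k x < nonneg_rat j < jump_time W k x + e.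
  by apply: nonneg_rat_dense; rewrite ?ltrDl// jump_time_ge0.
apply: ge_ereal_inf; exists (nonneg_rat j)%:E; last by rewrite -EFinD lee_fin ltW.
by exists j => //; rewrite ifT//; apply/NP => //; [exact: nonneg_rat_ge0|exact: ltW].
Qed.

Local Notation TN := (g_sigma_algebraType (\bigcup_(t in [set t : R | 0 <= t])
  preimage_set_system setT (N t) measurable)).

Lemma measurable_jump_time_of_counting k :
  measurable_fun setT (jump_time_of_counting k : TN -> \bar R).
Proof.
apply: measurable_fun_einfs => j; apply: measurable_fun_ifT => //.
apply: measurable_fun_lee => //.
by apply: measurable_fun_generated_sigma; exact: nonneg_rat_ge0.
Qed.

(** Waiting times are differences of jump times, which can be recovered from the counting process;
    this lets independence from that process pass to the waiting times. *)
Lemma generated_sigma_waiting_tuple n (B : set (n.-tuple R)) : measurable B ->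
  exists2 A, generated_sigma [set t : R | 0 <= t] N A &
    forall x, (forall j, 0 < W j x) -> A x <-> B [tuple W i x | i < n].
Proof.
move=> mB; pose V (x : TN) : n.-tuple R := [tuple
  fine (jump_time_of_counting i.+1 x) - fine (jump_time_of_counting i x) | i < n].
have mV : measurable_fun setT V.
  apply/measurable_fun_tnthP => i.
  rewrite (_ : _ \o _ = (fun x => fine (jump_time_of_counting i.+1 x) -
      fine (jump_time_of_counting i x))); last first.
    by apply/funext => x /=; rewrite tnth_mktuple.
  apply: measurable_funB;
    apply: (measurableT_comp (fine_measurable measurableT));
    exact: measurable_jump_time_of_counting.
exists (V @^-1` B); first by have := mV measurableT _ mB; rewrite setTI.
move=> x W0; rewrite /preimage/=; suff -> : V x = [tuple W i x | i < n] by [].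
apply: eq_from_tnth => i; rewrite !tnth_mktuple !jump_time_of_countingE//=.
by rewrite /jump_time big_ord_recr/= addrAC subrr add0r.
Qed.

End jump_times_from_counting_process.

Section exponential_positive.
Context d (T : measurableType d) (R : realType) (P : probability T R).
Variables (lambda : R) (W : nat -> {RV P >-> R}).
Hypothesis W_exp : forall (k : nat) (A : set R), measurable A ->
  distribution P (W k) A = exponential_prob lambda A.

Lemma exponential_waiting_times_gt0 : {ae P, forall x, forall k, 0 < W k x}.
Proof.
apply: ae_foralln => k; exists (W k @^-1` `]-oo, 0]%classic); split.
- exact: measurable_funPTI.
- transitivity (exponential_prob lambda `]-oo, 0]%classic).
    exact: W_exp (measurable_itv _).
  (* The end point 0 is Lebesgue negligible, and the density vanishes on the negative reals. *)
  rewrite /exponential_prob -integral_itv_bndo_bndc; last first.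
    by apply/measurable_funTS/measurable_EFinP; exact: measurable_exponential_pdf.
  apply: integral0_eq => x; rewrite /= in_itv/= => x0.
  by rewrite lt0_exponential_pdf.
- by move=> x /=; rewrite in_itv/= leNgt => /negP.
Qed.

End exponential_positive.

Section bounded_by_one.
Context d (T : measurableType d) (R : realType) (P : probability T R).
Variable h : T -> R.
Hypothesis mh : measurable_fun setT h.
Hypothesis h_le1 : forall x, `|h x| <= 1.

Lemma integral_one : (\int[P]_x 1 = 1)%E.
Proof. by rewrite integral_cst// [X in (1 * X)%E]probability_setT mule1. Qed.

Lemma integrable_le1 : P.-integrable setT (EFin \o h).
Proof.
apply: (@le_integrable _ _ _ P _ measurableT _ (cst 1%E)).
- exact/measurable_EFinP.
- by move=> x _; rewrite /= normr1 lee_fin.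
- exact: finite_measure_integrable_cst.
Qed.

(** Adding 1 makes [h] nonnegative, so that Tonelli's theorem applies; this identity undoes the
    shift. *)
Lemma integral_add1 :
  (\int[P]_x (h x + 1)%:E = (\int[P]_x h x + 1)%:E)%E.
Proof.
under eq_integral do rewrite EFinD.
rewrite integralD//; [|exact: integrable_le1|exact: finite_measure_integrable_cst].
rewrite integral_one EFinD fineK//.
exact: integrable_fin_num integrable_le1.
Qed.

Lemma normr_Rintegral_le1 : `|\int[P]_x h x| <= 1.
Proof.
apply: (le_trans (le_normr_Rintegral measurableT integrable_le1)).
rewrite -lee_fin fineK; last first.
  exact: (integrable_fin_num measurableT (integrable_norm integrable_le1)).
apply: (@le_trans _ _ (\int[P]_x 1)%E); last by rewrite integral_one.
apply: ge0_le_integral => //.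
- by apply/measurable_EFinP; exact: measurableT_comp.
- by move=> x _; rewrite lee_fin.
Qed.

End bounded_by_one.

(** * Differences and partial sums in matrix form *)

Section matrices.
Context {R : realType}.

(** The transpose moves to the other argument. The inner sum has at most one term, and none in the
    first row. *)
Lemma dotv_diff_mx n (xi s : 'cV[R]_n) :
  dotv ((diff_mx n)^T *m xi) s =
  \sum_i xi i 0 * (s i 0 - \sum_(j < n | i == j.+1 :> nat) s j 0).
Proof.
have dotE (u v : 'cV[R]_n) : dotv u v = (u^T *m v) 0 0.
  by rewrite !mxE; apply: eq_bigr => i _; rewrite mxE.
rewrite dotE trmx_mul trmxK -mulmxA -dotE; apply: eq_bigr => i _.
congr (_ * _); rewrite mulmxBl mul1mx !mxE; congr (_ - _).
rewrite [RHS]big_mkcond/=; apply: eq_bigr => j _; rewrite mxE.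
by case: ifPn => _; rewrite (mul1r, mul0r).
Qed.

Lemma sum_pred_ord n (i : 'I_n) (s : nat -> R) :
  \sum_(j < n | i == j.+1 :> nat) s j = if i == 0%N :> nat then 0 else s i.-1.
Proof.
case: ifPn => [/eqP ->|i0]; first by rewrite big_pred0.
have i1 : (i.-1 < n)%N by rewrite (leq_ltn_trans (leq_pred i)).
rewrite (bigD1 (Ordinal i1)) ?prednK ?lt0n//= big1 ?addr0// => j /andP[/eqP ij /eqP].
by case; apply: val_inj; rewrite /= ij.
Qed.

Lemma lower_ones_mulE n (w : n.-tuple R) (i : 'I_n) :
  (lower_ones_mx n *m col_of_tuple w) i 0 = \sum_(j < n | (j <= i)%N) tnth w j.
Proof.
rewrite mxE [RHS]big_mkcond; apply: eq_bigr => j _.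
by rewrite !mxE; case: ifPn => _; rewrite (mul1r, mul0r).
Qed.

Lemma lower_ones_mul_wtuple T (W : nat -> T -> R) n (x : T) (i : 'I_n) :
  (lower_ones_mx n *m col_of_tuple [tuple W i x | i < n]) i 0 =
  jump_time W i.+1 x.
Proof.
rewrite lower_ones_mulE /jump_time (big_ord_widen n (fun j => W j x)) ?ltn_ord//.
by apply: eq_big => [j|j _]; rewrite ?ltnS// tnth_mktuple.
Qed.

Lemma measurable_lower_ones_mul n (i : 'I_n) : measurable_fun setT
  (fun w : n.-tuple R => (lower_ones_mx n *m col_of_tuple w) i 0).
Proof.
under eq_fun do rewrite lower_ones_mulE big_mkcond.
apply: measurable_sum => j; case: (j <= i)%N => //; exact: measurable_tnth.
Qed.

End matrices.

(** * Waiting times under an independent time change *)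

Section independent_time_change.
Context d (T : measurableType d) (R : realType) (P : probability T R).
Variables (lambda : R) (W : nat -> {RV P >-> R}) (sigma : R -> {RV P >-> R}).
Hypothesis lambda_gt0 : 0 < lambda.
Hypothesis W_exp : forall (k : nat) (A : set R), measurable A ->
  distribution P (W k) A = exponential_prob lambda A.
Hypothesis W_indep : mutually_independent P W.
Hypothesis sigma_indep : independent_systems P
  (generated_sigma [set t : R | 0 <= t] sigma)
  (generated_sigma [set t : R | 0 <= t] (fun t => counting_process W t%:E)).
Hypothesis sigma_right_cont : forall (x : T) (t : R), 0 <= t ->
  sigma s x @[s --> t^'+] --> sigma t x.
Hypothesis sigma_incr : {ae P, forall x, forall s t : R,
  0 <= s -> s < t -> sigma s x < sigma t x}.
Hypothesis sigma_no_fixed_jump : forall t : R, 0 < t ->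
  {ae P, forall x, {for t, continuous (fun s => sigma s x)}}.
Hypothesis sigma0 : {ae P, forall x, sigma 0 x = 0}.

Local Notation GS := (\bigcup_(t in [set t : R | 0 <= t])
  preimage_set_system setT (sigma t) measurable).
Local Notation TS := (g_sigma_algebraType GS).

Let GSm : <<s GS >> `<=` measurable.
Proof. exact: generated_sigma_measurable. Qed.

Lemma measurable_generating_process d' (E : measurableType d') (t : R) : 0 <= t ->
  measurable_fun setT (fun z : E * TS => sigma t z.2).
Proof.
move=> t0; have mst := @measurable_fun_generated_sigma _ _ _ _
  [set t : R | 0 <= t] (fun t => sigma t : T -> R) t t0.
exact: (measurableT_comp mst measurable_snd).
Qed.

Lemma measurable_counting_process (t : R) :
  measurable_fun setT (fun x => counting_process W t%:E x).
Proof.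
rewrite (_ : (fun x => _) = (fun x => esups
    (fun n => if jump_time W n x <= t then n%:R%:E else -oo%E) 0)).
  apply: measurable_fun_esups => n; apply: measurable_fun_ifT => //.
  by apply: measurable_fun_ler => //; exact: measurable_jump_time.
apply/funext => x; apply/eqP; rewrite eq_le; apply/andP; split.
  apply/ereal_supP => _ [n /= nt <-]; apply: ereal_sup_ubound.
  by exists n => //=; rewrite -lee_fin nt.
apply/ereal_supP => _ [n _ <-]; case: ifPn => [nt|_]; last by rewrite leNye.
by apply: ereal_sup_ubound; exists n => //=; rewrite lee_fin.
Qed.

(** The event on the waiting times is almost surely equal to one generated by the counting process,
    where [sigma_indep] applies. *)
Lemma wtuple_indep n (A : set T) (B : set (n.-tuple R)) :
  <<s GS >> A -> measurable B ->
  (P (A `&` wtuple W n @^-1` B) = P A * P (wtuple W n @^-1` B))%E.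
Proof.
move=> GA mB; have [C GC CB] := generated_sigma_waiting_tuple W mB.
have mA := GSm GA.
have mC : measurable C.
  by apply: generated_sigma_measurable GC => t _; exact: measurable_counting_process.
have mWB : measurable (wtuple W n @^-1` B).
  by rewrite -[X in measurable X]setTI; exact: measurable_wtuple.
have W0 := exponential_waiting_times_gt0 W_exp.
have PC : P C = P (wtuple W n @^-1` B).
  by apply: measure_eq_ae => //; apply: filterS W0 => x /CB.
rewrite -PC -(sigma_indep GA GC); apply: measure_eq_ae.
- exact: measurableI.
- exact: measurableI.
- by apply: filterS W0 => x /CB xCB; split => -[Ax /xCB].
Qed.

(** Once the waiting times are frozen, the jump time is a deterministic positive time, at which
    [sigma] is almost surely continuous; independence lets these null sections be assembled into a
    null event. *)
Lemma sigma_continuous_at_jump_times : {ae P, forall x, forall n,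
  left_sup (sigma ^~ x) (jump_time W n.+1 x) =
  (sigma (jump_time W n.+1 x) x)%:E}.
Proof.
apply: ae_foralln => n.
pose s (w : n.+1.-tuple R) := \sum_(i < n.+1) tnth w i.
have ms : measurable_fun setT s by apply: measurable_sum => i; exact: measurable_tnth.
have sW x : s (wtuple W n.+1 x) = jump_time W n.+1 x.
  by apply: eq_bigr => i _; rewrite tnth_mktuple.
pose X (t : R) (z : n.+1.-tuple R * TS) : R := sigma t z.2.
have mX t : 0 <= t -> measurable_fun setT (X t).
  by move=> t0; exact: measurable_generating_process.
pose lft z := left_sup (X ^~ z) (s z.1).
(* Truncation at 0 keeps the time in the domain of right-continuity for every tuple. *)
pose val z := X (Num.max 0 (s z.1)) z.
have ms1 : measurable_fun setT (fun z : n.+1.-tuple R * TS => s z.1).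
  exact: (measurableT_comp ms measurable_fst).
have mlft : measurable_fun setT lft by exact: measurable_left_sup.
have mval : measurable_fun setT val.
  apply: measurable_right_continuous_at => //.
  - by move=> z t t0; exact: sigma_right_cont.
  - exact: measurable_maxr.
  - by move=> z; rewrite le_max lexx.
pose D : set (n.+1.-tuple R * TS) := [set z | lft z != (val z)%:E].
have mD : measurable D.
  rewrite /D (_ : [set z | _] = ~` ([set z | (lft z <= (val z)%:E)%E] `&`
      [set z | ((val z)%:E <= lft z)%E])).
    apply: measurableC; apply: measurableI; rewrite -[X in measurable X]setTI;
      apply: measurable_lee => //; exact/measurable_EFinP.
  apply/seteqP; split => z /=; rewrite eq_le.
    by move=> /negP h ab; apply: h; exact/andP.
  by move=> h; apply/negP => /andP.
(* The exceptional tuples, whose sum is not a positive time; they have probability 0 since the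
   waiting times are almost surely positive. *)
pose N : set (n.+1.-tuple R) := [set w | s w <= 0].
have mN : measurable N.
  rewrite (_ : N = s @^-1` `]-oo, 0]%classic).
    by rewrite -[X in measurable X]setTI; exact: ms.
  by apply/seteqP; split => w; rewrite /N/= in_itv.
have W0 := exponential_waiting_times_gt0 W_exp.
have mWn := @measurable_wtuple _ _ _ P W n.+1.
have P0 : P [set x | D (wtuple W n.+1 x, x)] = 0%E.
  apply: (negligible_independent GSm mWn (@wtuple_indep n.+1) mD mN).
    rewrite -(measure0 P); apply: measure_eq_ae => //.
      by rewrite -[X in measurable X]setTI; exact: mWn.
    apply: filterS W0 => x W0; split => //.
    rewrite /N/= sW leNgt -(jump_time0 W x).
    by rewrite (lt_le_trans (lt_jump_timeS W0 0))// le_jump_time.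
  move=> w /= /negP; rewrite -ltNge => sw0.
  rewrite -(measure0 P); apply: measure_eq_ae => //.
    by apply: GSm; exact: (@measurable_xsection _ _ _ TS).
  apply: filterS3 sigma_incr sigma0 (sigma_no_fixed_jump sw0) => x incr x0 cont.
  split => //; rewrite /xsection/= inE /D/= => /eqP; apply.
  rewrite /lft /val /X/= max_r ?ltW//.
  by apply: left_sup_continuous => //; exact: sigma_right_cont.
have : {ae P, forall x, ~ D (wtuple W n.+1 x, x)}.
  exists [set x | D (wtuple W n.+1 x, x)]; split => //.
    have := measurable_with_id GSm mWn measurableT mD.
    by rewrite setTI.
  by move=> x /= /contrapT.
apply: filterS2 W0 => x W0 /negP; rewrite negbK /lft /val /X/= sW => /eqP ->.
by rewrite max_r// jump_time_ge0.
Qed.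

(** Continuity at jump times turns left suprema into values of [sigma]. At [T_0 = 0] the left
    supremum is 0, hence the separate case. *)
Lemma waiting_time_ae : {ae P, forall x, forall n,
  waiting_time W sigma n x =
  sigma (jump_time W n.+1 x) x -
  (if n == 0%N then 0 else sigma (jump_time W n x) x)}.
Proof.
have W0 := exponential_waiting_times_gt0 W_exp.
have good : {ae P, forall x, [/\ forall k, 0 < W k x,
    forall s t : R, 0 <= s -> s < t -> sigma s x < sigma t x & sigma 0 x = 0]}.
  by apply: filterS3 W0 sigma_incr sigma0 => x; split.
apply: filterS2 good sigma_continuous_at_jump_times => x [Wx incr x0] cont n.
rewrite (waiting_time_path sigma_right_cont)// cont /=; congr (_ - _).
case: n => [|n]; last by rewrite cont.
by rewrite /= jump_time0 left_sup0//; exact: sigma_right_cont.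
Qed.

(** Partial sums [B_n W] are the jump times, and [A_n] takes successive differences of [sigma]
    there; its first row has no subtracted term, matching the case [n = 0] above. *)
Lemma dotv_waiting_times_ae n (xi : 'cV[R]_n) : {ae P, forall x,
  dotv xi (\col_i waiting_time W sigma i x) =
  dotv ((diff_mx n)^T *m xi)
    (sample sigma (lower_ones_mx n *m col_of_tuple (wtuple W n x)) x)}.
Proof.
apply: filterS waiting_time_ae => x Jx; rewrite dotv_diff_mx.
have sE (i : 'I_n) :
    sample sigma (lower_ones_mx n *m col_of_tuple (wtuple W n x)) x i 0 =
    sigma (jump_time W i.+1 x) x.
  by rewrite mxE (lower_ones_mul_wtuple W).
apply: eq_bigr => i _; rewrite mxE Jx sE; congr (_ * (_ - _)).
under eq_bigr do rewrite sE.
rewrite (sum_pred_ord i (fun k => sigma (jump_time W k.+1 x) x)).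
by case: ifPn => // i0; rewrite prednK// lt0n.
Qed.

(** * Bounded transforms, to be used with cosine and sine *)

Section transform.
Variables (n : nat) (xi : 'cV[R]_n) (g : R -> R).
Hypothesis mg : measurable_fun setT g.
Hypothesis g_le1 : forall a, `|g a| <= 1.

Local Notation eta := ((diff_mx n)^T *m xi).
Local Notation D := (@nonneg_orthant R n).
Local Notation times w := (lower_ones_mx n *m col_of_tuple w).
Let J x : 'cV[R]_n := \col_i waiting_time W sigma i x.

(* Negative times are truncated to have a function measurable on the whole
   space; this is harmless on the nonnegative orthant. *)
Let F (z : n.-tuple R * TS) : R :=
  g (\sum_i eta i 0 * sigma (Num.max 0 (times z.1 i 0)) z.2).

Let FE w x : D w -> F (w, x) = g (dotv eta (sample sigma (times w) x)).
Proof.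
move=> w0; rewrite /F /dotv; congr g; apply: eq_bigr => i _ /=.
have t0 : 0 <= (times w) i 0.
  by rewrite lower_ones_mulE; apply: sumr_ge0 => j _; exact: w0.
have -> : sample sigma (times w) x i 0 = sigma ((times w) i 0) x by rewrite mxE.
by rewrite max_r.
Qed.

Let mF : measurable_fun setT F.
Proof.
apply: (measurableT_comp mg); apply: measurable_sum => i.
apply: measurable_funM => //.
apply: (measurable_right_continuous_at
  (X := fun t (z : n.-tuple R * TS) => sigma t z.2)
  (tau := fun z => Num.max 0 (times z.1 i 0))).
- by move=> t t0; exact: measurable_generating_process.
- by move=> z t t0; exact: sigma_right_cont.
- apply: measurable_maxr => //.
  exact: (measurableT_comp (measurable_lower_ones_mul i) measurable_fst).
- by move=> z; rewrite le_max lexx.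
Qed.

Let F1 (z : n.-tuple R * TS) : \bar R := (F z + 1)%:E.

Let mF1 : measurable_fun setT F1.
Proof. by apply/measurable_EFinP; exact: measurable_funD. Qed.

Let F1_ge0 z : (0 <= F1 z)%E.
Proof.
rewrite lee_fin -lerBlDr sub0r.
by have : `|F z| <= 1 := g_le1 _; rewrite ler_norml => /andP[].
Qed.

Let dens (w : n.-tuple R) : R :=
  lambda ^+ n * expR (- lambda * \sum_(j < n) tnth w j).

(** Almost surely the integrand is [F1] at the pair of waiting times and sample point; independence
    averages over [sigma] with the tuple frozen, and the density of the waiting times gives the
    outer integral. *)
Lemma integral_bounded_transform :
  (\int[P]_x (g (dotv xi (J x)) + 1)%:E =
   \int[lebesgue_tuple n]_(w in D) ((\int[P]_x F1 (w, x)) * (dens w)%:E))%E.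
Proof.
rewrite -(ge0_integral_wtuple lambda_gt0 W_exp W_indep
  (f := fun w => (\int[P]_x F1 (w, x))%E)); last 2 first.
- exact: (measurable_integral_coarser P GSm mF1).
- by move=> w; apply: integral_ge0.
rewrite -(ge0_integral_independent GSm (@measurable_wtuple _ _ _ P W n)
  (@wtuple_indep n) mF1 F1_ge0).
apply: ae_eq_integral => //.
- apply/measurable_EFinP/measurable_funD => //; apply: (measurableT_comp mg).
  apply: measurable_sum => i; apply: measurable_funM => //.
  under eq_fun do rewrite mxE.
  by apply: measurable_waiting_time => //; exact: sigma_right_cont.
- exact: (measurableT_comp mF1
    (measurable_with_id GSm (@measurable_wtuple _ _ _ P W n))).
apply: filterS2 (exponential_waiting_times_gt0 W_exp) (dotv_waiting_times_ae xi)
  => x W0 Jx _.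
rewrite /F1 FE -?Jx// => i.
by rewrite tnth_mktuple ltW.
Qed.

(** For [g] cosine or sine, the real or imaginary part of the characteristic function of
    [sigma(B_n w)] at [A_n^T xi]. *)
Let G (w : n.-tuple R) : R :=
  \int[P]_x g (dotv eta (sample sigma (times w) x)).

Let mFw w : measurable_fun setT (fun x : T => F (w, x)).
Proof. exact: (measurable_fun_coarser GSm (measurable_fun_pair2 w mF)). Qed.

Let F_le1 z : `|F z| <= 1.
Proof. exact: g_le1. Qed.

Let integral_F1 w : D w -> (\int[P]_x F1 (w, x) = (G w + 1)%:E)%E.
Proof.
move=> w0; rewrite /F1 integral_add1 //; congr (_ + _)%:E.
by apply: eq_Rintegral => x _; rewrite FE.
Qed.

Let G_le1 w : D w -> `|G w| <= 1.
Proof.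
move=> w0; rewrite (_ : G w = \int[P]_x F (w, x)); last first.
  by apply: eq_Rintegral => x _; rewrite FE.
exact: normr_Rintegral_le1.
Qed.

Let mD : measurable D.
Proof. exact: measurable_nonneg_orthant. Qed.

Let mdens : measurable_fun setT dens.
Proof.
apply: measurable_funM => //; apply: measurableT_comp => //.
apply: measurable_funM => //; apply: measurable_sum => i.
exact: measurable_tnth.
Qed.

Let dens_ge0 w : 0 <= dens w.
Proof. by rewrite mulr_ge0 ?expR_ge0// exprn_ge0// ltW. Qed.

(** The total mass is read off by integrating the constant 1 against the law of the waiting
    times. *)
Let integral_dens : (\int[lebesgue_tuple n]_(w in D) (dens w)%:E = 1)%E.
Proof.
have := ge0_integral_wtuple lambda_gt0 W_exp W_indep (n := n)
  (measurable_cst 1%E) (fun=> lee01).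
rewrite integral_one => ->.
by apply: eq_integral => w _; rewrite mul1e.
Qed.

Let integrable_dens : (lebesgue_tuple n).-integrable D (EFin \o dens).
Proof.
apply/integrableP; split; first exact/measurable_EFinP/measurable_funTS.
under eq_integral do rewrite /= ger0_norm//.
by rewrite integral_dens ltry.
Qed.

Let integrable_G : (lebesgue_tuple n).-integrable D (EFin \o (fun w => G w * dens w)).
Proof.
apply: (le_integrable mD _ _ integrable_dens).
  apply/measurable_EFinP; apply: measurable_funM; last exact: measurable_funTS.
  (* On the orthant [G] coincides with the integral of [F1] minus 1, whose measurability is
     known. *)
  apply: (@eq_measurable_fun _ _ _ _ D
      (fun w => fine (\int[P]_x F1 (w, x)) - 1)).
    by move=> w /[!inE] w0; rewrite integral_F1//= addrK.
  apply: measurable_funB => //; apply: measurable_funTS.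
  apply: (measurableT_comp (fine_measurable measurableT)).
  exact: (measurable_integral_coarser P GSm mF1).
move=> w w0; rewrite /= lee_fin normrM ler_piMl// G_le1//.
Qed.

(** The shift by 1 contributes exactly 1 on both sides, because [dens] has mass 1, and cancels. *)
Lemma Rintegral_transform :
  \int[P]_x g (dotv xi (J x)) =
  lambda ^+ n * \int[lebesgue_tuple n]_(w in D)
    (G w * expR (- lambda * \sum_(j < n) tnth w j)).
Proof.
have mJ : measurable_fun setT (fun x => g (dotv xi (J x))).
  apply: (measurableT_comp mg); apply: measurable_sum => i.
  apply: measurable_funM => //; under eq_fun do rewrite mxE.
  by apply: measurable_waiting_time => //; exact: sigma_right_cont.
have := integral_bounded_transform; rewrite integral_add1//.
have -> : (\int[lebesgue_tuple n]_(w in D) (\int[P]_x F1 (w, x) * (dens w)%:E) =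
    \int[lebesgue_tuple n]_(w in D) ((G w * dens w)%:E + (dens w)%:E))%E.
  apply: eq_integral => w /[!inE] w0.
  by rewrite integral_F1// -EFinM mulrDl mul1r EFinD.
rewrite integralD// integral_dens => /(congr1 fine).
rewrite fineD//=; last exact: integrable_fin_num integrable_G.
move=> /addIr ->.
have -> : (fun w : n.-tuple R => G w * expR (- lambda * \sum_(j < n) tnth w j)) =
    (fun w => (lambda ^+ n)^-1 * (G w * dens w)).
  apply/funext => w; rewrite /dens [RHS]mulrCA mulKf//.
  by rewrite expf_neq0// gt_eqF.
by rewrite RintegralZl// mulrA divff ?mul1r// expf_neq0// gt_eqF.
Qed.

End transform.

End independent_time_change.

Theorem theorem3p1 (R : realType) (d : measure_display) (T : measurableType d)
  (P : probability T R) (d' : measure_display) (S : measurableType d')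
  (lambda : R) (Mt : nat -> {RV P >-> S}) (W : nat -> {RV P >-> R})
  (sigma : R -> {RV P >-> R})
  (lambda_gt0 : 0 < lambda)
  (Mt_markov : markov_chain P Mt)
  (W_exp : forall (k : nat) (A : set R), measurable A ->
    distribution P (W k) A = exponential_prob lambda A)
  (W_indep : mutually_independent P W)
  (Mt_N_indep : independent_systems P
    (generated_sigma setT Mt)
    (generated_sigma [set t : R | 0 <= t]
      (fun t => counting_process W t%:E)))
  (sigma_indep : independent_systems P
    (generated_sigma [set t : R | 0 <= t] sigma)
    <<s generated_sigma setT Mt `|`
        generated_sigma [set t : R | 0 <= t]
      (fun t => counting_process W t%:E) >>)
  (sigma_right_cont : forall (x : T) (t : R), 0 <= t ->
    sigma s x @[s --> t^'+] --> sigma t x)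
  (sigma_incr : {ae P, forall x, forall s t : R,
    0 <= s -> s < t -> sigma s x < sigma t x})
  (sigma_no_fixed_jump : forall t : R, 0 < t ->
    {ae P, forall x, {for t, continuous (fun s => sigma s x)}})
  (sigma0 : {ae P, forall x, sigma 0 x = 0}) :
  let J := waiting_time W sigma in
  let Y := time_changed_chain W sigma Mt in
  [/\ {ae P, forall x, forall (n : nat) (t : R),
        \sum_(k < n) J k x <= t < \sum_(k < n.+1) J k x -> Y t x = Mt n x},
      {ae P, forall x, forall n : nat,
        J n x = sigma (jump_time W n.+1 x) x -
                left_limit (fun s => sigma s x) (jump_time W n x)},
      forall k : nat, measurable_fun setT (J k) &
      forall (n : nat) (xi : 'cV[R]_n), (0 < n)%N ->
        char_fun P (fun x => \col_(i < n) J i x) xi =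
        (lambda ^+ n)%:C%C *
        complex_integral (lebesgue_tuple n) (@nonneg_orthant R n)
          (fun w =>
             char_fun P
               (sample sigma (lower_ones_mx n *m col_of_tuple w))
               ((diff_mx n)^T *m xi) *
             (expR (- lambda * \sum_(j < n) tnth w j))%:C%C)].
Proof.
move=> J Y.
have sigma_N_indep : independent_systems P
    (generated_sigma [set t : R | 0 <= t] sigma)
    (generated_sigma [set t : R | 0 <= t] (fun t => counting_process W t%:E)).
  by move=> A B GA NB; apply: sigma_indep => //; apply: sub_sigma_algebra; right.
have W_gt0 := exponential_waiting_times_gt0 W_exp.
split.
- apply: filterS3 W_gt0 sigma_incr sigma0 => x W0 incr x0 n t.
  exact: time_changed_chain_path.
- have good : {ae P, forall x, [/\ forall k, 0 < W k x,
      forall s t : R, 0 <= s -> s < t -> sigma s x < sigma t x & sigma 0 x = 0]}.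
    by apply: filterS3 W_gt0 sigma_incr sigma0 => x; split.
  have cont := sigma_continuous_at_jump_times W_exp sigma_N_indep sigma_right_cont
    sigma_incr sigma_no_fixed_jump sigma0.
  apply: filterS2 good cont => x [W0 incr x0] cont n.
  rewrite /J (waiting_time_path sigma_right_cont)// cont left_limitE//.
    exact: sigma_right_cont.
  exact: jump_time_ge0.
- move=> k; apply: measurable_waiting_time => // x t; exact: sigma_right_cont.
move=> n xi _.
have cos_le1 (a : R) : `|cos a| <= 1 by rewrite ler_norml cos_geN1 cos_le1.
have sin_le1 (a : R) : `|sin a| <= 1 by rewrite ler_norml sin_geN1 sin_le1.
have transform := Rintegral_transform lambda_gt0 W_exp W_indep sigma_N_indep
  sigma_right_cont sigma_incr sigma_no_fixed_jump sigma0 (n := n) xi.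
rewrite /char_fun /complex_integral /=.
have mcos := continuous_measurable_fun (@continuous_cos R).
have msin := continuous_measurable_fun (@continuous_sin R).
(* The real and imaginary parts are the transforms for cosine and sine; the scalar factors are real,
   so no cross terms remain. *)
rewrite (transform _ mcos cos_le1) (transform _ msin sin_le1).
apply/eqP; rewrite eq_complex /=; apply/andP; split; apply/eqP.
- rewrite mul0r subr0; congr (_ * _); apply: eq_Rintegral => w _.
  by rewrite mulr0 subr0.
- rewrite mul0r addr0; congr (_ * _); apply: eq_Rintegral => w _.
  by rewrite mulr0 add0r.
Qed.
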